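(* Let $s>2$ be a prime power and let $\ell\geq 2$ and $\tilde{\kappa}$ be positive integers with $\tilde{\kappa}\leq s-1$. Then there exists an array $A\in\{1,\ldots,s\}^{2s^{\ell}\times\left(2\frac{s^{\ell}-1}{s-1}-1+\tilde{\kappa}\right)}$ (with $N=2s^{\ell}$ runs, $k=2\frac{s^{\ell}-1}{s-1}-1+\tilde{\kappa}$ factors and $s$ levels) such that: (0) $A$ is an orthogonal array of strength one; (1a) the first $2\frac{s^{\ell}-1}{s-1}-1$ columns of $A$ form an orthogonal array of strength two; (1b) if we remove the first column of $A$ and any $\tilde{\kappa}-1$ of the last $\tilde{\kappa}$ columns of $A$, the remaining columns form an orthogonal array of strength two; (2) $\mathrm{Tol}_2(A)=\max\{2,s-2\}\,s^{\ell-2}$; (3) for every $p\in[1,\infty)$, $\mathrm{Unb}_{p,2}(A)=\binom{\tilde{\kappa}+1}{2}\,2s(s-2)\left((s-2)^{p-1}+2^{p-1}\right)s^{(\ell-2)p}$.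
   Context: For an $N\times k$ array $A$ with entries in a set $S$ of size $s$ and $t\leq k$, let $T_{t,k}=\{(j_1,\ldots,j_t)\in[k]^t: 1\leq j_1<\cdots<j_t\leq k\}$, and for $x\in S^t$, $j\in T_{t,k}$ let $n(A,x,j)=\#\{i\in[N]: A_{i,j_r}=x_r \text{ for all } r\in[t]\}$. $A$ is an orthogonal array of strength $t$ if $n(A,x,j)=N/s^t$ for all $x\in S^t$, $j\in T_{t,k}$ (a set of columns ''forms an orthogonal array of strength $t$'' if the subarray consisting of those columns does). The tolerance of strength $t$ is $\mathrm{Tol}_t(A)=\max\{|n(A,x,j)-N/s^t|: x\in S^t, j\in T_{t,k}\}$, and for $p\in[1,\infty)$ the $p$-unbalance of strength $t$ is $\mathrm{Unb}_{p,t}(A)=\sum_{x\in S^t}\sum_{j\in T_{t,k}}|n(A,x,j)-N/s^t|^p$. *)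

(* Defs.v *)
From mathcomp Require Import all_boot all_order all_algebra.
From mathcomp Require Import reals exp.

Set Implicit Arguments.
Unset Strict Implicit.
Unset Printing Implicit Defensive.

Import Order.TTheory GRing.Theory Num.Theory.

Definition prime_power (s : nat) : Prop :=
  exists q m : nat, [/\ prime q, 0 < m & s = q ^ m].

Definition col_tuples (t k : nat) : {set t.-tuple 'I_k} :=
  [set j : t.-tuple 'I_k | sorted (fun a b : 'I_k => a < b) j].

Section Arrays.

Variables (S : finType) (N k : nat).
Implicit Types (A : 'M[S]_(N, k)) (C : {set 'I_k}).

Definition run_count A t (x : t.-tuple S) (j : t.-tuple 'I_k) : nat :=
  #|[set i : 'I_N | [forall r : 'I_t, A i (tnth j r) == tnth x r]]|.

Definition deviation (R : realFieldType) A t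
    (x : t.-tuple S) (j : t.-tuple 'I_k) : R :=
  `|(run_count A x j)%:R - N%:R / #|S|%:R ^+ t|%R.

Definition orthogonal_array A (t : nat) : Prop :=
  forall (x : t.-tuple S) (j : t.-tuple 'I_k), j \in col_tuples t k ->
    ((run_count A x j)%:R = N%:R / #|S|%:R ^+ t :> rat)%R.

(* Deviations are nonnegative, so the default value 0 of the iterated maximum
   only matters when it ranges over the empty set (t > k or S empty). *)
Definition Tol (R : realFieldType) A (t : nat) : R :=
  \big[Order.max/0%R]_(x : t.-tuple S)
    \big[Order.max/0%R]_(j in col_tuples t k) deviation R A x j.

Definition Unb (R : realType) (p : R) A (t : nat) : R :=
  (\sum_(x : t.-tuple S) \sum_(j in col_tuples t k) deviation R A x j `^ p)%R.

(* enum_val lists the indices in C in increasing order. *)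
Definition subarray A C : 'M[S]_(N, #|C|) :=
  colsub (fun i : 'I_#|C| => enum_val i) A.

End Arrays.

(* Main.v *)
Require Import Defs.
From mathcomp Require Import all_boot all_order all_algebra all_field.
From mathcomp Require Import reals exp.
From mathcomp Require Import ring.

Import Order.TTheory GRing.Theory Num.Theory.

Set Implicit Arguments.
Unset Strict Implicit.

(* Let F be the field with s elements. Over the 2s runs (b, x) in bool * F, the
   kappa + 1 special columns are x + b * c_i with distinct shifts c_i: in the
   pair (i, j) the level g meets only the levels g and g - c_i + c_j, once each.
   Given a difference matrix D whose rows are the current runs, replace the run
   set X by X * F and adjoin the columns (x, y) |-> D x z + y. They are
   orthogonal to one another and to any column of strength one depending only on
   x, whatever the unbalance among the latter. Starting from a 2s x 2s difference
   matrix, whose size is multiplied by s at each step by adding the multiplication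
   table of F, l - 1 steps give 2 (s + ... + s ^ (l - 1)) further columns, while
   the counts of the special pairs get multiplied by s ^ (l - 1). *)

(** * Maps with fibres of equal size *)

(** A column is balanced when it is uniform, and two columns are orthogonal when the pair of them is
    uniform into the product. The product form of the equation avoids a division. *)
Definition uniform (X G : finType) (f : X -> G) : Prop :=
  forall g, #|[set x | f x == g]| * #|G| = #|X|.

Lemma card_sum_fibers (X G : finType) (f : X -> G) (P : pred G) :
  #|[set x | P (f x)]| = \sum_(g | P g) #|[set x | f x == g]|.
Proof.
rewrite -sum1_card (partition_big f P) => [|x]; last by rewrite inE.
apply: eq_bigr => g Pg; rewrite -sum1_card; apply: eq_bigl => x.
by rewrite !inE; case: eqP => [->|]; rewrite ?Pg ?andbF.
Qed.

Lemma uniform_preim (X G : finType) (f : X -> G) (P : pred G) :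
  uniform f -> #|[set x | P (f x)]| * #|G| = #|[set g | P g]| * #|X|.
Proof.
move=> uf; rewrite card_sum_fibers big_distrl /=.
rewrite (eq_bigr (fun=> #|X|)) => [|g _]; last exact: uf.
by rewrite sum_nat_const cardsE.
Qed.

(** The fibre sizes add up to [c * #|G|], so none can fall short of the bound [c]. Thus bounding the
    number of solutions of an equation is enough to prove uniformity. *)
Lemma uniform_of_le (X G : finType) (f : X -> G) c :
  #|X| = c * #|G| -> (forall g, #|[set x | f x == g]| <= c) -> uniform f.
Proof.
move=> cX le_c g; rewrite cX; congr (_ * _).
have sumX : \sum_g #|[set x | f x == g]| = #|X|.
  by rewrite -(card_sum_fibers f predT) cardsT.
apply/eqP; rewrite eqn_leq le_c leqNgt; apply/negP => lt_c.
have: \sum_g #|[set x | f x == g]| < \sum_(g : G) c.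
  rewrite (bigD1 g) //= [ltnRHS](bigD1 g) //= -addSn leq_add //.
  by apply: leq_sum => h _; exact: le_c.
by rewrite sumX sum_nat_const cX mulnC ltnn.
Qed.

Lemma uniform_bij (X G : finType) (f : X -> G) : bijective f -> uniform f.
Proof.
move=> [f' fK f'K] g; rewrite (_ : [set _ | _] = [set f' g]).
  by rewrite cards1 mul1n (bij_eq_card (Bijective fK f'K)).
by apply/setP => x; rewrite !inE (can2_eq fK f'K).
Qed.

Lemma uniform_comp (X Y G : finType) (f : X -> Y) (g : Y -> G) :
  uniform f -> uniform g -> uniform (g \o f).
Proof.
(* When [Y] is empty there is no factor [#|Y|] to cancel, but then [X] is empty too. *)
move=> uf ug z; have [/card0_eq Y0|Y_gt0] := posnP #|Y|.
  have X0 : #|X| = 0 by apply: eq_card0 => x; have := Y0 (f x); rewrite !inE.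
  by rewrite eq_card0 ?X0 // => x; have := Y0 (f x); rewrite !inE.
apply/eqP; rewrite -(eqn_pmul2r Y_gt0) mulnAC.
by rewrite (uniform_preim (fun y => g y == z) uf) mulnAC ug mulnC.
Qed.

Lemma eq_uniform (X G : finType) (f g : X -> G) :
  f =1 g -> uniform f -> uniform g.
Proof.
move=> fg uf z; rewrite -(uf z); congr (#|pred_of_set _| * _).
by apply/setP => x; rewrite !inE fg.
Qed.

Lemma uniform_pair_map (X Y G H : finType) (f : X -> G) (g : Y -> H) :
  uniform f -> uniform g -> uniform (fun z : X * Y => (f z.1, g z.2)).
Proof.
move=> uf ug [a b]; rewrite !card_prod.
rewrite (_ : [set _ | _] = setX [set x | f x == a] [set y | g y == b]).
  by rewrite cardsX mulnACA uf ug.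
by apply/setP => -[x y]; rewrite !inE.
Qed.

Lemma uniform_fst (X Y : finType) : uniform (@fst X Y).
Proof.
move=> x; rewrite (_ : [set _ | _] = setX [set x] setT).
  by rewrite cardsX cards1 mul1n cardsT card_prod mulnC.
by apply/setP => -[x' y]; rewrite !inE andbT.
Qed.

Lemma uniform_snd (X Y : finType) : uniform (@snd X Y).
Proof.
move=> y; rewrite (_ : [set _ | _] = setX setT [set y]).
  by rewrite cardsX cards1 muln1 cardsT card_prod.
by apply/setP => -[x y']; rewrite !inE.
Qed.

Lemma card_le2 (T : finType) (A : {set T}) a b :
  (forall x, x \in A -> x = a \/ x = b) -> #|A| <= 2.
Proof.
move=> sA; have /subset_leq_card/leq_trans : A \subset [set a; b].
  by apply/subsetP => x /sA[]->; rewrite !inE eqxx ?orbT.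
by apply; rewrite cards2; case: (_ != _).
Qed.

(** * Difference matrices and the tower of adjoined columns *)

Section DifferenceMatrices.

Local Open Scope ring_scope.

Variable F : finFieldType.

Definition difference_matrix (X Y : finType) (D : X -> Y -> F) : Prop :=
  forall y y', y != y' -> uniform (fun x => D x y - D x y').

Lemma shear_bij (X : finType) (q : X -> F) (c : F) : c != 0 ->
  bijective (fun z : X * F => (z.1, q z.1 + z.2 * c)).
Proof.
move=> c0; exists (fun z : X * F => (z.1, (z.2 - q z.1) / c)) => -[x t] /=.
  by rewrite addrC addKr mulfK.
by rewrite divfK // addrC subrK.
Qed.

(** The shear [(x, t) |-> (x, q x + t)] permutes [X * F] and turns the map into the product of [p]
    and the identity. *)
Lemma uniform_develop (X P : finType) (p : X -> P) (q : X -> F) :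
  uniform p -> uniform (fun z : X * F => (p z.1, q z.1 + z.2)).
Proof.
move=> up; have ui : uniform (@id F) by apply: uniform_bij; exists id.
have := uniform_comp (uniform_bij (shear_bij q (oner_neq0 F)))
  (uniform_pair_map up ui).
by apply: eq_uniform => -[x t] /=; rewrite mulr1.
Qed.

(** The difference of the two columns together with the second column is uniform, and
    [(u, v) |-> (u + v, v)] recovers the pair from it. *)
Lemma uniform_develop_difference (X Y : finType) (D : X -> Y -> F) y y' :
  difference_matrix D -> y != y' ->
  uniform (fun z : X * F => (D z.1 y + z.2, D z.1 y' + z.2)).
Proof.
move=> dD nyy; pose g (w : F * F) := (w.1 + w.2, w.2).
have bg : bijective g.
  by exists (fun w : F * F => (w.1 - w.2, w.2)) => -[u v]; rewrite /g /= ?addrK ?subrK.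
apply: eq_uniform (uniform_comp (uniform_develop (D^~ y') (dD _ _ nyy)) (uniform_bij bg)).
by move=> [x t]; rewrite /g /= addrA subrK.
Qed.

(** If [v = v'], the added terms cancel and a difference of columns of [D] remains. Otherwise, for
    fixed [x], the term [t * (v - v')] runs once through [F]. *)
Lemma kronecker_difference_matrix (X Y : finType) (D : X -> Y -> F) :
  difference_matrix D ->
  difference_matrix (fun (x : X * F) (y : Y * F) => D x.1 y.1 + x.2 * y.2).
Proof.
move=> dD [y v] [y' v'] ne /=; have [evv|nvv] := eqVneq v v'.
  have ny : y != y' by apply: contraNneq ne => ->; rewrite evv.
  apply: eq_uniform (uniform_comp (@uniform_fst X F) (dD _ _ ny)) => -[x t] /=.
  by rewrite evv opprD addrACA subrr addr0.
have nz : v - v' != 0 by rewrite subr_eq0.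
apply: eq_uniform (uniform_comp (uniform_bij
  (shear_bij (fun x => D x y - D x y') nz)) (@uniform_snd X F)) => -[x t] /=.
by rewrite mulrBr opprD addrACA.
Qed.

(** Induction on [n], where [K] indexes the columns adjoined so far and [pi] recovers the initial
    run. Nothing is asked of pairs of columns of [u], so these may be as unbalanced as desired. *)
Lemma orthogonal_tower (U X0 Y0 : finType) (D0 : X0 -> Y0 -> F)
    (u : X0 -> U -> F) n :
  difference_matrix D0 -> (forall i, uniform (u^~ i)) ->
  exists (X Y K : finType) (D : X -> Y -> F) (pi : X -> X0) (a : X -> K -> F),
    [/\ difference_matrix D, uniform pi,
        #|X| = (#|X0| * #|F| ^ n)%N, #|Y| = (#|Y0| * #|F| ^ n)%N
      & #|K| = (\sum_(i < n) #|Y0| * #|F| ^ i)%N] /\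
    [/\ forall k, uniform (a^~ k),
        forall k k', k != k' -> uniform (fun x => (a x k, a x k'))
      & forall k i, uniform (fun x => (u (pi x) i, a x k))].
Proof.
move=> dD0 uu; elim: n => [|n [X [Y [K [D [pi [a [[dD upi cX cY cK] [ua uaa uau]]]]]]]]].
  exists X0, Y0, void, D0, id, (fun _ (v : void) => match v with end).
  do 2!split=> //; rewrite ?muln1 ?big_ord0 ?card_void //.
  by apply: uniform_bij; exists id.
(* The old columns ignore the new coordinate; each column of [D] is developed along it into a new
   column. *)
pose a' (z : X * F) (k : K + Y) :=
  match k with inl k => a z.1 k | inr y => D z.1 y + z.2 end.
have ufst := @uniform_fst X F.
exists (X * F)%type, (Y * F)%type, (K + Y)%type,
  (fun x y => D x.1 y.1 + x.2 * y.2), (pi \o fst), a'; split; split.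
- exact: kronecker_difference_matrix.
- exact: uniform_comp.
- by rewrite card_prod cX expnSr mulnA.
- by rewrite card_prod cY expnSr mulnA.
- by rewrite card_sum cK cY big_ord_recr.
- case=> [k|y] /=; first exact: (uniform_comp ufst (ua k)).
  exact: (uniform_comp (uniform_develop (D^~ y) upi) (@uniform_snd X0 F)).
- have swap : bijective (fun w : F * F => (w.2, w.1)).
    by exists (fun w => (w.2, w.1)) => -[].
  case=> [k|y] [k'|y'] ne /=.
  + exact: (uniform_comp ufst (uaa _ _ ne)).
  + exact: (uniform_develop (D^~ y') (ua k)).
  + exact: (uniform_comp (uniform_develop (D^~ y) (ua k')) (uniform_bij swap)).
  + exact: uniform_develop_difference.
- case=> [k|y] i /=; first exact: (uniform_comp ufst (uau k i)).
  exact: (uniform_develop (D^~ y) (uniform_comp upi (uu i))).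
Qed.

(** * A difference matrix of order [2 * #|F|] *)

Lemma uniform_halves (f : bool * F -> F) :
  (forall g, #|[set x | f x == g]| <= 2)%N -> uniform f.
Proof. by apply: uniform_of_le; rewrite card_prod card_bool. Qed.

Lemma uniform_inj_halves (f : bool * F -> F) :
  (forall b, injective (fun x => f (b, x))) -> uniform f.
Proof.
move=> injf; have bf b : bijective (fun x => f (b, x)) by exact: injF_bij.
apply: uniform_halves => g.
have [h1 h1K _] := bf true; have [h2 h2K _] := bf false.
apply: (@card_le2 _ _ (true, h1 g) (false, h2 g)) => -[[] x]; rewrite inE => /eqP <-.
  by left; rewrite h1K.
by right; rewrite h2K.
Qed.

(** Exchanging two columns negates their difference, and negation is a bijection, so one order of
    the two types suffices. *)
Lemma difference_matrix_halves (D : bool * F -> bool * F -> F) :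
  (forall b y y', y != y' -> uniform (fun x => D x (b, y) - D x (b, y'))) ->
  (forall y y', uniform (fun x => D x (false, y) - D x (true, y'))) ->
  difference_matrix D.
Proof.
move=> same diff [b y] [b' y'] ne; have [eb|nb] := eqVneq b b'.
  by rewrite -eb; apply: same; apply: contraNneq ne => ->; rewrite eb.
have opp_bij : bijective (@GRing.opp F) by exists (@GRing.opp F); exact: opprK.
case: b b' nb {ne} => [] [] // _.
apply: eq_uniform (uniform_comp (diff y' y) (uniform_bij opp_bij)) => x.
by rewrite /= opprB.
Qed.

(** Supplies the parameters of the two matrices below: a nonsquare when [2 != 0], and a value missed
    by [z ^+ 2 + z] when [2 = 0]. *)
Lemma not_surj_of_not_inj (f : F -> F) x y :
  x != y -> f x = f y -> exists t, forall z, f z != t.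
Proof.
move=> nxy fxy; have [/forallP sf|] := boolP [forall t, [exists z, f z == t]].
  have cf : #|codom f| = #|F|.
    apply: eq_card => t; have /existsP[z /eqP <-] := sf t.
    by rewrite codom_f inE.
  by move/eqP/image_injP: cf => /(_ x y isT isT fxy) exy; rewrite exy eqxx in nxy.
by case/forallPn => t /existsPn nt; exists t.
Qed.

(** The bits [h] and [g] are the types of the row and of the column. Within one column type a
    difference is affine in [x] with slope [2 * (y - y')] or [2 * v * (y - y')]; the terms in
    [y ^+ 2] equalize the constants of the two halves for columns of different type. *)
Definition odd_matrix (v : F) (r c : bool * F) : F :=
  let: (h, x) := r in let: (g, y) := c in
  match h, g with
  | false, false => x ^+ 2 + 2 * x * y
  | false, true => 2 * v * x * y
  | true, false => v * x ^+ 2 + 2 * v * x * y + (v - 1) * y ^+ 2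
  | true, true => 2 * v * x * y + (v ^+ 2 - v) * y ^+ 2
  end.

(* For columns of different type both halves complete the square with the same
   constant, w = a ^+ 2 + K and w = v * b ^+ 2 + K, and v is not a square. *)
Lemma odd_matrix_difference (v : F) :
  2 != 0 :> F -> (forall z, z ^+ 2 != v) -> difference_matrix (odd_matrix v).
Proof.
move=> nz2 nsq; have nzv : v != 0.
  by have := nsq 0; rewrite expr0n /= eq_sym.
apply: difference_matrix_halves => [b y y' nyy|y y'].
  have lin (c f1 f2 x1 x2 : F) :
      c != 0 -> f1 - f2 = c * (x1 - x2) -> f1 = f2 -> x1 = x2.
    move=> c0 + e; rewrite e subrr => /esym/eqP.
    by rewrite mulf_eq0 (negPf c0) subr_eq0 => /eqP.
  have nzy : y - y' != 0 by rewrite subr_eq0.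
  have nz2vy : 2 * v * (y - y') != 0 by rewrite !mulf_neq0.
  have nz2y : 2 * (y - y') != 0 by rewrite mulf_neq0.
  apply: uniform_inj_halves => -[] x1 x2; case: b => /=.
  - by apply: (lin _ _ _ _ _ nz2vy); ring.
  - by apply: (lin _ _ _ _ _ nz2vy); ring.
  - by apply: (lin _ _ _ _ _ nz2vy); ring.
  - by apply: (lin _ _ _ _ _ nz2y); ring.
apply: uniform_halves => w.
pose K := - (y - v * y') ^+ 2; pose c0 := y - v * y'; pose c1 := y - y'.
have E0 x : odd_matrix v (false, x) (false, y) - odd_matrix v (false, x) (true, y')
    = (x + c0) ^+ 2 + K by rewrite /odd_matrix /K /c0; ring.
have E1 x : odd_matrix v (true, x) (false, y) - odd_matrix v (true, x) (true, y')
    = v * (x + c1) ^+ 2 + K by rewrite /odd_matrix /K /c1; ring.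
(* The value [K] is the only one taken by both halves, once in each. *)
have [->|nwK] := eqVneq w K.
  apply: (@card_le2 _ _ (false, - c0) (true, - c1)) => -[[] x]; rewrite inE.
    rewrite E1 -subr_eq0 addrK mulf_eq0 (negPf nzv) expf_eq0 /= addr_eq0.
    by move/eqP->; right.
  by rewrite E0 -subr_eq0 addrK expf_eq0 /= addr_eq0 => /eqP->; left.
have sqrt_eq (a b c : F) : (a + c) ^+ 2 = (b + c) ^+ 2 -> a = b \/ a = - b - c - c.
  move/eqP; rewrite eqf_sqr => /orP[/eqP/addIr|/eqP e]; [by left|right].
  by rewrite -[LHS](addrK c) e; ring.
have halves x x' : (x + c0) ^+ 2 + K = w -> v * (x' + c1) ^+ 2 + K <> w.
  move=> e0 e1; have e : v * (x' + c1) ^+ 2 = (x + c0) ^+ 2.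
    by apply: (addIr K); rewrite e0 e1.
  have [z0|nz] := eqVneq (x' + c1) 0.
    by rewrite -e1 z0 expr0n /= mulr0 add0r eqxx in nwK.
  by have /eqP[] := nsq ((x + c0) / (x' + c1)); rewrite expr_div_n -e mulfK // expf_neq0.
have [->|[[h x0]]] :=
  set_0Vmem [set x | odd_matrix v x (false, y) - odd_matrix v x (true, y') == w].
  by rewrite cards0.
rewrite inE => /eqP e0.
(* All solutions lie in the half of [x0], and the other root is the reflection of [x0] about the
   centre of the square. *)
apply: (@card_le2 _ _ (h, x0) (h, - x0 - (if h then c1 else c0) - (if h then c1 else c0))).
move=> [h' x]; rewrite inE; case: h e0; case: h' => /=; rewrite ?E0 ?E1 => e0 /eqP e1.
- have e2 : (x + c1) ^+ 2 = (x0 + c1) ^+ 2.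
    by apply: (mulfI nzv); apply: (addIr K); rewrite e0 e1.
  by case: (sqrt_eq _ _ _ e2) => ->; [left|right].
- by case: (halves _ _ e1 e0).
- by case: (halves _ _ e0 e1).
- have e2 : (x + c0) ^+ 2 = (x0 + c0) ^+ 2 by apply: (addIr K); rewrite e0 e1.
  by case: (sqrt_eq _ _ _ e2) => ->; [left|right].
Qed.

(* For columns of different type with y + y' = Y != 0, substituting x = Y * z
   turns the two halves into Y ^+ 2 * (z ^+ 2 + z) and Y ^+ 2 * (z ^+ 2 + z + t):
   each takes every value at most twice, and no value is taken by both. *)
Definition even_matrix (t : F) (r c : bool * F) : F :=
  let: (h, x) := r in let: (g, y) := c in
  x * y + (if h then t * y ^+ 2 else 0) + (if g then x ^+ 2 else 0).

Lemma even_matrix_difference (t : F) :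
  2 = 0 :> F -> (forall z, z ^+ 2 + z != t) -> difference_matrix (even_matrix t).
Proof.
move=> ch2 nt; have oppE (x : F) : - x = x.
  by apply/eqP; rewrite -subr_eq0 -opprD oppr_eq0 -mulr2n -mulr_natl ch2 mul0r.
apply: difference_matrix_halves => [b y y' nyy|y y'].
  have nzy : y - y' != 0 by rewrite subr_eq0.
  apply: uniform_inj_halves => h x1 x2 /eqP; rewrite -subr_eq0 /even_matrix => e.
  suff: (x1 - x2) * (y - y') == 0 by rewrite mulf_eq0 (negPf nzy) orbF subr_eq0 => /eqP.
  by apply: etrans e; congr (_ == _); case: (h) (b) => [] []; ring.
pose Y := y + y'.
have E h x : even_matrix t (h, x) (false, y) - even_matrix t (h, x) (true, y')
    = x ^+ 2 + x * Y + (if h then t * Y ^+ 2 else 0).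
  (* The tactic [ring] does not know the characteristic, so an explicit multiple of [2] makes the
     identity hold over any ring and is then discarded. *)
  transitivity (x ^+ 2 + x * Y + (if h then t * Y ^+ 2 else 0)
    - 2 * (x ^+ 2 + x * y' + (if h then t * (y * y' + y' ^+ 2) else 0))).
    by rewrite /even_matrix /Y; case: h; ring.
  by rewrite ch2 mul0r subr0.
have sqr_inj (a b : F) : a ^+ 2 = b ^+ 2 -> a = b.
  by move/eqP; rewrite eqf_sqr oppE orbb => /eqP.
(* For [Y = 0] both halves reduce to [x ^+ 2], which is injective in characteristic two. *)
have [Y0|nzY] := eqVneq Y 0.
  apply: uniform_inj_halves => h x1 x2; rewrite !E Y0 !mulr0 !addr0.
  by move/addIr/sqr_inj.
have root_eq (a b : F) : a ^+ 2 + a * Y = b ^+ 2 + b * Y -> a = b \/ a = b + Y.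
  move/eqP; rewrite -subr_eq0 => e.
  have: (a - b) * (a - (b + Y)) == 0.
    rewrite -(eqP e); apply/eqP.
    transitivity (a ^+ 2 + a * Y - (b ^+ 2 + b * Y)
      + 2 * (b ^+ 2 + b * Y - a * b - a * Y)); first by ring.
    by rewrite ch2 mul0r addr0.
  by rewrite mulf_eq0 !subr_eq0 => /orP[]/eqP; [left|right].
(* Adding a value of one half to an equal value of the other shows that [z = (a + b) / Y] would
   solve [z ^+ 2 + z = t]. *)
have halves a b : a ^+ 2 + a * Y <> b ^+ 2 + b * Y + t * Y ^+ 2.
  move=> e; have {}e : (a + b) ^+ 2 + (a + b) * Y = t * Y ^+ 2.
    transitivity (a ^+ 2 + a * Y - (b ^+ 2 + b * Y) + 2 * (a * b + b ^+ 2 + b * Y)).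
      by ring.
    by rewrite e ch2 mul0r addr0 addrC addKr.
  have /eqP[] := nt ((a + b) / Y).
  by rewrite -[RHS](mulfK (expf_neq0 2 nzY)) -e; field.
apply: uniform_halves => w.
have [->|[[h x0]]] :=
  set_0Vmem [set x | even_matrix t x (false, y) - even_matrix t x (true, y') == w].
  by rewrite cards0.
rewrite inE E => /eqP e0.
apply: (@card_le2 _ _ (h, x0) (h, x0 + Y)) => -[h' x]; rewrite inE E => /eqP.
case: h h' e0 => [] []; rewrite ?addr0 => <- e1.
- by move/addIr/root_eq: e1 => [->|->]; [left|right].
- by case: (halves _ _ e1).
- by case: (halves _ _ (esym e1)).
- by case: (root_eq _ _ e1) => ->; [left|right].
Qed.

Lemma exists_difference_matrix :
  exists D : bool * F -> bool * F -> F, difference_matrix D.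
Proof.
have [ch2|nz2] := eqVneq (2 : F) 0.
  have [t nt] : exists t : F, forall z, z ^+ 2 + z != t.
    apply: (@not_surj_of_not_inj (fun z => z ^+ 2 + z) 0 1).
      by rewrite eq_sym oner_neq0.
    by rewrite expr0n addr0 expr1n -mulr2n ch2.
  by exists (even_matrix t); exact: even_matrix_difference.
have [v nv] : exists v : F, forall z, z ^+ 2 != v.
  apply: (@not_surj_of_not_inj (fun z => z ^+ 2) 1 (- 1)).
    by rewrite -subr_eq0 opprK -mulr2n.
  by rewrite sqrrN.
by exists (odd_matrix v); exact: odd_matrix_difference.
Qed.

End DifferenceMatrices.

(** * The special columns *)

Section ShiftedColumns.

Local Open Scope ring_scope.

Variables (F : finFieldType) (I : eqType) (c : I -> F).
Hypothesis c_inj : injective c.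

Definition shifted (z : bool * F) (i : I) : F := z.2 + (if z.1 then c i else 0).

Lemma uniform_shifted i : uniform (shifted^~ i).
Proof. by apply: uniform_inj_halves => b x y /addIr. Qed.

(** The runs [(false, g)] and [(true, g - c i)] are the only ones with level [g] in column [i]. The
    relation [S] hides the shifts: the deviations need only that each level meets exactly two
    others. *)
Lemma shifted_pair i j : i != j -> exists S : rel F,
  (forall g, #|[set h | S g h]| = 2%N) /\
  forall g h, #|[set z | (shifted z i == g) && (shifted z j == h)]| = S g h.
Proof.
move=> nij; exists (fun g h => (h == g) || (h == g - c i + c j)); split => g.
  rewrite (_ : [set _ | _] = [set g; g - c i + c j]).
    by rewrite cards2 -addrA -subr_eq0 opprD addNKr oppr_eq0 addrC subr_eq0
      (inj_eq c_inj) eq_sym nij.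
  by apply/setP => h; rewrite !inE.
move=> h; have [->|nhg] /= := eqVneq h g.
  rewrite (_ : [set _ | _] = [set (false, g)]) ?cards1 //.
  apply/setP => -[[] x]; rewrite !inE /shifted /= xpair_eqE /= ?addr0 ?andbb //.
  apply/negP => /andP[/eqP <- /eqP/addrI/c_inj ij].
  by rewrite ij eqxx in nij.
have [->|nh] /= := eqVneq h (g - c i + c j).
  rewrite (_ : [set _ | _] = [set (true, g - c i)]) ?cards1 //.
  apply/setP => -[[] x]; rewrite !inE /shifted /= xpair_eqE /= ?addr0.
    rewrite (inj_eq (addIr _)) -[x + c i == g](inj_eq (addIr (- c i))) addrK.
    exact: andbb.
  apply/negP => /andP[/eqP -> /eqP/esym/eqP].
  by rewrite -addrA -subr_eq0 addrAC subrr add0r addrC subr_eq0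
    (inj_eq c_inj) eq_sym (negPf nij).
apply: eq_card0 => -[[] x]; rewrite !inE /shifted /= ?addr0.
  by apply/negP => /andP[/eqP e1 /eqP e2]; rewrite -e1 -e2 addrK eqxx in nh.
by apply/negP => /andP[/eqP e1 /eqP e2]; rewrite -e1 -e2 eqxx in nhg.
Qed.

End ShiftedColumns.

(** * Assembling the array *)

(** The left summand will index the special columns, the right one the adjoined columns. *)
Definition is_left (T U : Type) (c : T + U) := if c is inl _ then true else false.

Lemma exists_uniform_family (F : finFieldType) kappa n : kappa < #|F| ->
  exists (X K : finType) (a : X -> 'I_kappa.+1 + K -> F),
  [/\ #|X| = 2 * #|F| ^ n.+1, #|K| = \sum_(i < n) 2 * #|F| ^ i.+1,
      forall c, uniform (a^~ c),
      forall c d, c != d -> ~~ (is_left c && is_left d) ->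
        uniform (fun x => (a x c, a x d))
    & forall c d, c != d -> is_left c -> is_left d -> exists S : rel F,
        (forall g, #|[set h | S g h]| = 2) /\
        forall g h, #|[set x | (a x c == g) && (a x d == h)]| = S g h * #|F| ^ n].
Proof.
(* The bound on [kappa] leaves room for [kappa + 1] distinct shifts in [F]. *)
move=> ltk; pose c (i : 'I_kappa.+1) : F := enum_val (widen_ord ltk i).
have c_inj : injective c.
  by move=> i j /enum_val_inj/(congr1 val)/= e; apply: val_inj.
have [D0 dD0] := exists_difference_matrix F.
have [X [Y [K [D [pi [a [[_ upi cX _ cK] [ua uaa uua]]]]]]]] :=
  orthogonal_tower n dD0 (uniform_shifted c).
have c0 : #|{: bool * F}| = 2 * #|F| by rewrite card_prod card_bool.
exists X, K, (fun x k => match k with inl i => shifted c (pi x) i | inr k => a x k end).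
have swap : bijective (fun w : F * F => (w.2, w.1)).
  by exists (fun w : F * F => (w.2, w.1)) => -[].
split.
- by rewrite cX c0 expnS mulnA.
- by rewrite cK; apply: eq_bigr => i _; rewrite c0 expnS mulnA.
- by case=> [i|k]; [exact: (uniform_comp upi (uniform_shifted c i))|exact: ua].
- case=> [i|k] [j|k'] ne //= _.
  + exact: (uniform_comp (uua k j) (uniform_bij swap)).
  + exact: (uaa k k' ne).
- case=> [i|k] [j|k'] //= ne _ _.
  have nij : i != j by apply: contraNneq ne => ->.
  have [S [S2 cS]] := shifted_pair c_inj nij.
  (* As [pi] is uniform, each count over the initial runs is multiplied by [#|X|] over [2 * #|F|],
     that is by [#|F| ^ n]. *)
  exists S; split=> // g h; have := uniform_preim
    (fun z => (shifted c z i == g) && (shifted c z j == h)) upi.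
  rewrite cS cX c0 [X in _ = _ * X]mulnC [RHS]mulnA => /eqP.
  rewrite eqn_pmul2r ?muln_gt0 //.
    by move/eqP.
  by apply: leq_ltn_trans (ltk).
Qed.

Lemma card_ord_bij (X : finType) n : #|X| = n -> exists e : 'I_n -> X, bijective e.
Proof. by move=> <-; exists enum_val; exact: enum_val_bij. Qed.

(** One special column comes first and the other [kappa] come last, around the [M] adjoined ones.
    Each removal of columns in the theorem then leaves a single special column. *)
Lemma exists_column_map (K : finType) M kappa : #|K| = M ->
  exists f : 'I_(M.+1 + kappa) -> 'I_kappa.+1 + K,
  injective f /\ forall j, is_left (f j) = (j == 0 :> nat) || (M < j).
Proof.
move=> /card_ord_bij[e /bij_inj e_inj].
pose f (j : 'I_(M.+1 + kappa)) : 'I_kappa.+1 + K :=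
  match split j with
  | inl i => if unlift ord0 i is Some k then inr (e k) else inl ord0
  | inr k => inl (lift ord0 k)
  end.
exists f; split.
  move=> i j; rewrite /f => E; apply: ord_inj; move: E.
  case: splitP => [i1 ->|i1 ->]; case: splitP => [j1 ->|j1 ->].
  - case: unliftP => [i2 ->|->]; case: unliftP => [j2 ->|->] // [].
    by move/e_inj->.
  - by case: unliftP => [i2 ->|->] // [].
  - by case: unliftP => [i2 ->|->] // [].
  - by case; rewrite !add0n => ->.
move=> j; rewrite /f; case: splitP => [i ->|k ->] /=.
  by case: unliftP => [k ->|->] //=; rewrite /bump /= add1n ltnS leqNgt ltn_ord.
by rewrite addSn ltnS leq_addr.
Qed.

Lemma prime_power_field s : prime_power s -> exists F : finFieldType, #|F| = s.
Proof.
move=> [q [m [pq m0 ->]]]; have [F _ cF] := PrimePowerField pq m0.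
by exists F.
Qed.

(** The constant term of the geometric sum contributes [2], of which the subtraction leaves [1]: the
    first special column. The other terms count the adjoined columns. *)
Lemma geometric_quotient s n : 1 < s ->
  2 * ((s ^ n.+1 - 1) %/ (s - 1)) - 1 = (\sum_(i < n) 2 * s ^ i.+1).+1.
Proof.
move=> s1; rewrite !subn1 predn_exp mulKn -?subn1 ?subn_gt0 //.
rewrite big_ord_recl expn0 mulnDr muln1 big_distrr /=.
by rewrite add2n subn1.
Qed.

Lemma exists_matrix s n kappa : prime_power s -> 1 < s -> kappa < s ->
  let m := 2 * ((s ^ n.+1 - 1) %/ (s - 1)) - 1 in
  let special (j : 'I_(m + kappa)) := (j == 0 :> nat) || (m <= j) in
  exists A : 'M['I_s]_(2 * s ^ n.+1, m + kappa),
  [/\ forall j x, #|[set i | A i j == x]| * s = 2 * s ^ n.+1,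
      forall j k, j != k -> ~~ (special j && special k) ->
        forall x y, #|[set i | (A i j == x) && (A i k == y)]| * s ^ 2 = 2 * s ^ n.+1
    & forall j k, j != k -> special j -> special k -> exists S : rel 'I_s,
        (forall x, #|[set y | S x y]| = 2) /\
        forall x y, #|[set i | (A i j == x) && (A i k == y)]| = S x y * s ^ n].
Proof.
move=> /prime_power_field[F <-] s1 ltk m; rewrite /m (geometric_quotient n s1) /=.
have [X [K [a [/card_ord_bij[e be] cK ua uaa usp]]]] := exists_uniform_family n ltk.
have [f [f_inj f_left]] := exists_column_map kappa cK.
have cardN : #|X| = 2 * #|F| ^ n.+1 by rewrite -(bij_eq_card be) card_ord.
have card_rows (P : pred X) : #|[set i | P (e i)]| = #|[set x | P x]|.
  rewrite -[RHS](on_card_preimset (onW_bij _ be)).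
  by congr #|pred_of_set _|; apply/setP => i; rewrite !inE.
exists (\matrix_(i, j) enum_rank (a (e i) (f j)))%R.
have rankE y (x : 'I_#|F|) : (enum_rank y == x) = (y == enum_val x).
  exact: (can2_eq enum_rankK enum_valK).
split=> [j x|j k njk nsp x y|j k njk spj spk].
- rewrite -[RHS]cardN -(ua (f j) (enum_val x)) -card_rows; congr (#|pred_of_set _| * _).
  by apply/setP => i; rewrite !inE mxE rankE.
- rewrite -[RHS]cardN -(uaa (f j) (f k) _ _ (enum_val x, enum_val y)).
  + rewrite -card_rows card_prod -mulnn; congr (#|pred_of_set _| * _).
    by apply/setP => i; rewrite !inE !mxE !rankE xpair_eqE.
  + by rewrite (inj_eq f_inj).
  + by rewrite !f_left.
- have [||| S [S2 cS]] := usp (f j) (f k); rewrite ?f_left ?(inj_eq f_inj) //.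
  exists (fun x y => S (enum_val x) (enum_val y)); split=> [x|x y].
    rewrite -(S2 (enum_val x)) -(card_imset _ (@enum_val_inj _ F)).
    congr #|pred_of_set _|; apply/setP => h; apply/imsetP/idP.
      by move=> [y]; rewrite !inE => Sxy ->.
    rewrite inE => Sxh; exists (enum_rank h); rewrite ?inE enum_rankK //.
  rewrite -cS -card_rows; congr #|pred_of_set _|.
  by apply/setP => i; rewrite !inE !mxE !rankE.
Qed.

(** * Pairs of columns and orthogonality of strength one and two *)

Lemma tuple2E (T : Type) (x : 2.-tuple T) :
  x = [tuple tnth x ord0; tnth x (lift ord0 ord0)].
Proof.
by apply: eq_from_tnth => i; case: (unliftP ord0 i) => [j|] ->; rewrite ?(ord1 j).
Qed.

Lemma tuple2_bij (T : finType) : bijective (fun p : T * T => [tuple p.1; p.2]).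
Proof.
exists (fun x : 2.-tuple T => (tnth x ord0, tnth x (lift ord0 ord0))) => [[a b]|x] //.
by rewrite [RHS]tuple2E.
Qed.

Lemma col_tuples2 n (j k : 'I_n) : ([tuple j; k] \in col_tuples 2 n) = (j < k).
Proof. by rewrite inE /= andbT. Qed.

(** Forgetting the order maps the increasing pairs with entries in [P] bijectively onto the
    two-element subsets of [P]. *)
Lemma card_col_tuples2 n (P : {set 'I_n}) :
  #|[set j in col_tuples 2 n | all (mem P) j]| = 'C(#|P|, 2).
Proof.
rewrite -cards_draws -(@card_in_imset _ _ (fun j : 2.-tuple 'I_n => [set x in j])).
  congr #|pred_of_set _|; apply/setP => B; apply/imsetP/idP.
    case=> j; rewrite (tuple2E j) inE col_tuples2 => /andP[lt_jk /= /and3P[Pj Pk _]] ->.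
    set a := tnth j _ in lt_jk Pj *; set b := tnth j _ in lt_jk Pk *.
    rewrite inE; apply/andP; split.
      by apply/subsetP => x; rewrite !inE => /orP[]/eqP->.
    rewrite (_ : [set _ in _] = [set a; b]); last by apply/setP => x; rewrite !inE.
    by rewrite cards2 neq_ltn lt_jk.
  rewrite inE => /andP[sBP /cards2P[a [b [nab eB]]]].
  wlog ltab : a b nab eB / a < b.
    move=> W; move: (nab); rewrite neq_ltn => /orP[]; first exact: W.
    by apply: W; rewrite 1?eq_sym // setUC.
  exists [tuple a; b]; last by rewrite eB; apply/setP => x; rewrite !inE.
  apply/setIdP; rewrite col_tuples2 ltab /= !(subsetP sBP) // eB !inE eqxx ?orbT //.
move=> x y /setIdP[ltx _] /setIdP[lty _] /setP; move: ltx lty.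
rewrite (tuple2E x) (tuple2E y) !col_tuples2.
move: (tnth x _) (tnth x _) (tnth y _) (tnth y _) => b a d c ltab ltcd e.
have := e c; have := e d; rewrite !inE !eqxx ?orbT.
move=> /orP[]/eqP ed /orP[]/eqP ec; subst c d.
- by rewrite ltnn in ltcd.
- by have := ltn_trans ltab ltcd; rewrite ltnn.
- by [].
- by rewrite ltnn in ltcd.
Qed.

Lemma run_count2 (S : finType) N k (A : 'M[S]_(N, k)) (x y : S) (i j : 'I_k) :
  run_count A [tuple x; y] [tuple i; j] =
  #|[set r | (A r i == x) && (A r j == y)]|.
Proof.
congr #|pred_of_set _|; apply/setP => r; rewrite !inE; apply/forallP/andP.
  by move=> h; split; [exact: (h ord0)|exact: (h (lift ord0 ord0))].
by move=> [h0 h1] t; case: (unliftP ord0 t) => [t'|] ->; rewrite ?(ord1 t').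
Qed.

Lemma ratio_of_count (K : realFieldType) (c q N : nat) :
  0 < q -> c * q = N -> (c%:R = N%:R / q%:R :> K)%R.
Proof. by move=> q0 <-; rewrite natrM mulfK // pnatr_eq0 -lt0n. Qed.

Lemma orthogonal_array1 (S : finType) N k (A : 'M[S]_(N, k)) :
  0 < #|S| -> (forall j x, #|[set r | A r j == x]| * #|S| = N) ->
  orthogonal_array A 1.
Proof.
move=> S0 cA x j _; rewrite expr1; apply: ratio_of_count => //.
rewrite -[RHS](cA (tnth j ord0) (tnth x ord0)); congr (#|pred_of_set _| * _).
apply/setP => r; rewrite !inE; apply/forallP/idP => [/(_ ord0)//|h i].
by rewrite ord1.
Qed.

Lemma orthogonal_subarray2 (S : finType) N k (A : 'M[S]_(N, k)) (C : {set 'I_k}) :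
  0 < #|S| ->
  (forall i j, i \in C -> j \in C -> i != j ->
    forall x y, #|[set r | (A r i == x) && (A r j == y)]| * #|S| ^ 2 = N) ->
  orthogonal_array (subarray A C) 2.
Proof.
move=> S0 cA x j; rewrite (tuple2E x) (tuple2E j) col_tuples2 => ltj.
rewrite run_count2 -natrX; apply: ratio_of_count; first by rewrite expn_gt0 S0.
set a := tnth j _ in ltj *; set b := tnth j _ in ltj *.
have nab : enum_val a != enum_val b.
  by apply: contraTneq ltj => /enum_val_inj->; rewrite ltnn.
rewrite -[RHS](cA _ _ (enum_valP a) (enum_valP b) nab
  (tnth x ord0) (tnth x (lift ord0 ord0))).
by congr (#|pred_of_set _| * _); apply/setP => r; rewrite !inE !mxE.
Qed.

(** * Tolerance and unbalance *)

Section Unbalanced.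

Variables (R : realType) (s n k : nat) (A : 'M['I_s]_(2 * s ^ n.+2, k)).
Variable P : {set 'I_k}.
Hypothesis s_gt2 : 2 < s.
Hypothesis balanced : forall i j, i != j -> ~~ ((i \in P) && (j \in P)) ->
  forall x y, #|[set r | (A r i == x) && (A r j == y)]| * s ^ 2 = 2 * s ^ n.+2.
Hypothesis special : forall i j, i != j -> i \in P -> j \in P ->
  exists S : rel 'I_s, (forall x, #|[set y | S x y]| = 2) /\
    forall x y, #|[set r | (A r i == x) && (A r j == y)]| = S x y * s ^ n.+1.

Local Open Scope ring_scope.

Let meanE : (2 * s ^ n.+2)%N%:R / #|'I_s|%:R ^+ 2 = (2 * s ^ n)%N%:R :> R.
Proof.
rewrite card_ord -natrX; apply/esym; apply: ratio_of_count.
  by rewrite expn_gt0; case: s s_gt2.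
by rewrite -mulnA -expnD addn2.
Qed.

Lemma deviation_balanced i j x y : i != j -> ~~ ((i \in P) && (j \in P)) ->
  deviation R A [tuple x; y] [tuple i; j] = 0.
Proof.
move=> nij nP; rewrite /deviation run_count2 card_ord -natrX.
rewrite (@ratio_of_count R _ _ _ _ (balanced nij nP x y)) ?subrr ?normr0 //.
by rewrite expn_gt0; case: s s_gt2.
Qed.

(** The mean is [2 * s ^ n] and the count is [s * s ^ n] or [0]. *)
Lemma deviation_special i j : i != j -> i \in P -> j \in P ->
  exists S : rel 'I_s, (forall x, #|[set y | S x y]| = 2)%N /\
    forall x y, deviation R A [tuple x; y] [tuple i; j] =
      ((if S x y then s - 2 else 2) * s ^ n)%N%:R.
Proof.
move=> nij Pi Pj; have [S [S2 cS]] := special nij Pi Pj.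
exists S; split=> // x y; rewrite /deviation run_count2 meanE cS.
case: (S x y); last by rewrite mul0n sub0r normrN normr_nat.
rewrite mul1n expnS !natrM -mulrBl normrM normr_nat; congr (_ * _).
by rewrite natrB ?ger0_norm ?subr_ge0 ?ler_nat // ltnW.
Qed.

Lemma Tol_special : (1 < #|P|)%N -> Tol R A 2 = (maxn 2 (s - 2) * s ^ n)%N%:R.
Proof.
move=> /card_gt1P[i [j [Pi Pj nij]]]; apply/eqP; rewrite eq_le; apply/andP; split.
  apply: bigmax_le => // x _; apply: bigmax_le => // t.
  rewrite (tuple2E x) (tuple2E t) col_tuples2.
  move: (tnth t _) (tnth t _) => b a ltab.
  have nab : a != b by rewrite neq_ltn ltab.
  have [/andP[Pa Pb]|nP] := boolP ((a \in P) && (b \in P)); last first.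
    by rewrite deviation_balanced.
  have [S [_ ->]] := deviation_special nab Pa Pb.
  by rewrite ler_nat leq_mul2r; case: (S _ _); rewrite ?leq_maxl ?leq_maxr orbT.
wlog ltij : i j Pi Pj nij / (i < j)%N.
  move=> W; move: (nij); rewrite neq_ltn => /orP[]; first exact: W.
  by apply: W; rewrite 1?eq_sym.
have [S [S2 dS]] := deviation_special nij Pi Pj.
have s_gt0 : (0 < s)%N by case: s s_gt2.
pose x0 := Ordinal s_gt0.
suff [y dy] : exists y, ((if S x0 y then s - 2 else 2) = maxn 2 (s - 2))%N.
  apply: (bigmax_sup [tuple x0; y]) => //.
  by apply: (bigmax_sup [tuple i; j]); rewrite ?col_tuples2 // dS dy.
(* The level [x0] is related to two levels and unrelated to [s - 2 > 0] others, so both deviations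
   occur, in particular the larger one. *)
have [le2|lt2] := leqP 2 (s - 2)%N.
  have /card_gt0P[y] : (0 < #|[set y | S x0 y]|)%N by rewrite S2.
  by rewrite inE => Sy; exists y; rewrite Sy.
have /card_gt0P[y] : (0 < #|~: [set y | S x0 y]|)%N.
  by rewrite cardsCs setCK S2 card_ord subn_gt0.
by rewrite !inE => /negPf Sy; exists y; rewrite Sy.
Qed.

Lemma sum_special (S : rel 'I_s) (u v : R) : (forall x, #|[set y | S x y]| = 2)%N ->
  \sum_(x : 2.-tuple 'I_s)
    (if S (tnth x ord0) (tnth x (lift ord0 ord0)) then u else v) =
  s%:R * (2 * u + (s - 2)%:R * v).
Proof.
move=> S2; rewrite (reindex _ (onW_bij _ (tuple2_bij _))) /=.
rewrite -(pair_bigA _ (fun x y => if S x y then u else v)) /=.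
have row x : \sum_y (if S x y then u else v) = 2 * u + (s - 2)%:R * v.
  rewrite (bigID (S x)) /= (eq_bigr (fun=> u)) => [|y ->//].
  rewrite [X in _ + X](eq_bigr (fun=> v)) => [|y /negPf->//].
  rewrite !sumr_const -[u *+ _]mulr_natl -[v *+ _]mulr_natl.
  congr (_%:R * _ + _%:R * _).
    by rewrite -(S2 x) cardsE.
  transitivity #|~: [set y | S x y]|; first by apply: eq_card => y; rewrite !inE.
  by rewrite cardsCs setCK S2 card_ord.
by rewrite (eq_bigr _ (fun x _ => row x)) sumr_const card_ord [RHS]mulr_natl.
Qed.

Lemma Unb_special (p : R) : 1 <= p -> Unb p A 2 =
  'C(#|P|, 2)%:R * (2 * s%:R * (s - 2)%:R)
  * ((s - 2)%:R `^ (p - 1) + 2 `^ (p - 1)) * s%:R `^ (n%:R * p).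
Proof.
move=> p1; have p0 : 0 < p by exact: lt_le_trans p1.
pose V : R :=
  s%:R * (2 * ((s - 2) * s ^ n)%N%:R `^ p + (s - 2)%:R * (2 * s ^ n)%N%:R `^ p).
rewrite /Unb exchange_big /=.
(* A balanced pair contributes zero because [p > 0]; every special pair contributes the same [V],
   whatever its relation [S]. *)
transitivity (\sum_(j in [set j in col_tuples 2 k | all (mem P) j]) V).
  rewrite [RHS]big_mkcond [LHS]big_mkcond /=; apply: eq_bigr => t _.
  have -> : (t \in [set j in col_tuples 2 k | all (mem P) j]) =
    (t \in col_tuples 2 k) && all (mem P) t by rewrite inE.
  rewrite (tuple2E t) col_tuples2 /= andbT; move: (tnth t _) (tnth t _) => b a.
  case: ifP => //= ltab.
  have nab : a != b by rewrite neq_ltn ltab.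
  case: ifPn => [/andP[Pa Pb]|nP]; last first.
    by apply: big1 => x _; rewrite (tuple2E x) deviation_balanced // powR0 // gt_eqF.
  have [S [S2 dS]] := deviation_special nab Pa Pb.
  rewrite /V -(sum_special _ _ S2); apply: eq_bigr => x _.
  by rewrite [in LHS](tuple2E x) dS; case: (S _ _).
rewrite sumr_const card_col_tuples2 -[LHS]mulr_natl -!mulrA; congr (_ * _).
(* Splitting one factor [c] off the power lets [2 * s * (s - 2)] be taken out of both terms of
   [V]. *)
have powE c :
    (c * s ^ n)%N%:R `^ p = c%:R * c%:R `^ (p - 1) * s%:R `^ (n%:R * p) :> R.
  by rewrite mulr_powRB1 // natrM powRM // powRrM powR_mulrn // natrX.
rewrite /V !powE; move: (2 `^ (p - 1)) ((s - 2)%:R `^ (p - 1)) (s%:R `^ _) => a b c.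
by move: (s%:R : R) ((s - 2)%:R : R) => u v; ring.
Qed.

End Unbalanced.

(** * Conclusion: the properties of the array *)

Lemma card_last_columns m kappa : #|[set j : 'I_(m + kappa) | m <= j]| = kappa.
Proof.
rewrite -[RHS]card_ord -(card_imset _ (@rshift_inj m kappa)).
apply: eq_card => j; rewrite inE; apply/idP/imsetP => [|[k _ ->]]; last exact: leq_addr.
by case: (split_ordP j) => [i|k] -> /=; [rewrite leqNgt ltn_ord|exists k].
Qed.

Lemma card_special_columns m kappa : 0 < m ->
  #|[set j : 'I_(m + kappa) | (j == 0 :> nat) || (m <= j)]| = kappa + 1.
Proof.
move=> m0; have m1 : 0 < m + kappa by rewrite addn_gt0 m0.
rewrite (_ : [set _ | _] = Ordinal m1 |: [set j : 'I_(m + kappa) | m <= j]).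
  by rewrite cardsU1 card_last_columns inE -ltnNge m0 addnC.
by apply/setP => j; rewrite !inE.
Qed.

Theorem theorem7p2 (R : realType) (s l kappa : nat)
    (s_gt2 : 2 < s) (s_pp : prime_power s) (l_ge2 : 2 <= l)
    (kappa_gt0 : 0 < kappa) (kappa_le : kappa <= s - 1) :
  let m := 2 * ((s ^ l - 1) %/ (s - 1)) - 1 in
  exists A : 'M['I_s]_(2 * s ^ l, m + kappa),
    [/\ orthogonal_array A 1,
        orthogonal_array (subarray A [set j : 'I_(m + kappa) | j < m]) 2,
        forall B : {set 'I_(m + kappa)},
          B \subset [set j : 'I_(m + kappa) | m <= j] -> #|B| = kappa - 1 ->
          orthogonal_array
            (subarray A (~: ([set j : 'I_(m + kappa) | j == 0 :> nat] :|: B))) 2,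
        Tol R A 2 = ((maxn 2 (s - 2) * s ^ (l - 2))%:R)%R
      & forall p : R, (1 <= p)%R ->
          Unb p A 2 =
            ('C(kappa + 1, 2)%:R * (2 * s%:R * (s - 2)%:R)
             * ((s - 2)%:R `^ (p - 1) + 2 `^ (p - 1))
             * s%:R `^ ((l - 2)%:R * p))%R].
Proof.
case: l l_ge2 => [|[|n]] // _ m; rewrite !subSS subn0.
have s_gt1 : 1 < s by exact: ltnW.
have ltks : kappa < s by rewrite -(subnK (ltnW s_gt1)) addn1 ltnS.
have m_gt0 : 0 < m by rewrite /m geometric_quotient.
have [A [cA1 cA2 cA3]] := exists_matrix n.+1 s_pp s_gt1 ltks.
rewrite -/m in A cA1 cA2 cA3 *; exists A.
pose P := [set j : 'I_(m + kappa) | (j == 0 :> nat) || (m <= j)].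
have cP : #|P| = kappa + 1 by exact: card_special_columns.
have balanced i j : i != j -> ~~ ((i \in P) && (j \in P)) -> forall x y,
    #|[set r | (A r i == x) && (A r j == y)]| * s ^ 2 = 2 * s ^ n.+2.
  by rewrite !inE; exact: cA2.
have special i j : i != j -> i \in P -> j \in P -> exists S : rel 'I_s,
    (forall x, #|[set y | S x y]| = 2) /\
    forall x y, #|[set r | (A r i == x) && (A r j == y)]| = S x y * s ^ n.+1.
  by rewrite !inE; exact: cA3.
have I_gt0 : 0 < #|'I_s| by rewrite card_ord; exact: ltnW.
(* Only pairs of special columns are unbalanced, so strength two holds as soon as at most one
   special column is kept. *)
have oa (C : {set 'I_(m + kappa)}) :
    {in C & C, forall i j, i \in P -> j \in P -> i = j} ->
    orthogonal_array (subarray A C) 2.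
  move=> PC; apply: orthogonal_subarray2 => // i j Ci Cj nij x y.
  rewrite card_ord balanced //; apply: contra nij => /andP[Pi Pj].
  exact/eqP/PC.
split.
- by apply: orthogonal_array1 => // j x; rewrite card_ord.
- apply: oa => i j; rewrite !inE => ltim ltjm.
  rewrite (leqNgt m i) (leqNgt m j) ltim ltjm !orbF => /eqP i0 /eqP j0.
  by apply: ord_inj; rewrite i0.
- move=> B sB cB; apply: oa => i j.
  rewrite !inE !negb_or => /andP[/negPf-> Bi] /andP[/negPf-> Bj] /= lei lej.
  (* Since [kappa > 0], removing [kappa - 1] of the last [kappa] columns leaves exactly one, and
     column [0] is gone as well. *)
  have /eqP/cards1P[a aE] : #|[set j : 'I_(m + kappa) | m <= j] :\: B| = 1.
    by rewrite cardsD (setIidPr sB) card_last_columns cB subKn.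
  have : i \in [set a] by rewrite -aE !inE Bi.
  have : j \in [set a] by rewrite -aE !inE Bj.
  by rewrite !inE => /eqP-> /eqP->.
- by apply: (Tol_special R s_gt2 balanced special); rewrite cP addn1 ltnS.
- by move=> p p1; rewrite (Unb_special s_gt2 balanced special p1) cP.
Qed.
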